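(* Let $X$ be a topological space and $Y$ a Hausdorff topological space. For $f\in\mathcal{M}(X,Y)$ let $\lambda(f)$ be the set of all filters on $\mathcal{M}(X,Y)$ that converge to $f$. Then $\lambda$ is a convergence structure on $\mathcal{M}(X,Y)$; that is, for every $f\in\mathcal{M}(X,Y)$: (1) $\langle f\rangle\in\lambda(f)$, where $\langle f\rangle$ is the filter generated by $\{\{f\}\}$; (2) if $\mathcal{F}_1,\mathcal{F}_2\in\lambda(f)$, then $\mathcal{F}_1\cap\mathcal{F}_2\in\lambda(f)$; (3) if $\mathcal{F}_1\in\lambda(f)$, then $\mathcal{F}_2\in\lambda(f)$ for every filter $\mathcal{F}_2$ on $\mathcal{M}(X,Y)$ finer than $\mathcal{F}_1$ (i.e. $\mathcal{F}_2\supseteq\mathcal{F}_1$).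
   Context: A set-valued map $g:X\to Y$ is usco if $g(x)$ is a nonempty compact subset of $Y$ for each $x\in X$ and $\{x\in X: g(x)\subset U\}$ is open in $X$ for each open $U\subset Y$. Set-valued maps are identified with their graphs, so $h\subset g$ means $h(x)\subset g(x)$ for all $x\in X$. A usco map $g$ is minimal if $h=g$ for every usco $h:X\to Y$ with $h\subset g$. $\mathcal{M}(X,Y)$ is the set of all minimal usco maps from $X$ to $Y$. For a usco map $g:X\to Y$, $[g]=\{f\in\mathcal{M}(X,Y): f\subset g\}$. A filter $\mathcal{F}$ on the set $\mathcal{M}(X,Y)$ converges to $f\in\mathcal{M}(X,Y)$ (written $\mathcal{F}\to f$) if $\{f\}=\bigcap\{[g]: g:X\to Y \text{ usco},\ [g]\in\mathcal{F}\}$; in particular at least one usco map $g$ with $[g]\in\mathcal{F}$ is required to exist. *)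

(* Defs.v *)
From mathcomp Require Import all_boot.
From mathcomp Require Import all_classical topology.

Set Implicit Arguments.
Unset Strict Implicit.
Unset Printing Implicit Defensive.

Local Open Scope classical_set_scope.

(* A set-valued map from X to Y is a function X -> set Y; inclusion of graphs
   is pointwise inclusion of values. *)
Definition sub_graph (X Y : Type) (h g : X -> set Y) : Prop :=
  forall x, h x `<=` g x.

Definition usco (X Y : topologicalType) (g : X -> set Y) : Prop :=
  (forall x, g x !=set0 /\ compact (g x)) /\
  (forall U : set Y, open U -> open [set x | g x `<=` U]).

Definition minimal_usco (X Y : topologicalType) (g : X -> set Y) : Prop :=
  usco g /\ forall h : X -> set Y, usco h -> sub_graph h g -> h = g.

Definition musco (X Y : topologicalType) : Type :=
  {f : X -> set Y | minimal_usco f}.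

(* Usually written [g]. *)
Definition below (X Y : topologicalType) (g : X -> set Y) :
    set (musco X Y) :=
  [set f | sub_graph (proj1_sig f) g].

(* The empty intersection is the whole of [musco X Y]; the existence clause
   rules it out explicitly. *)
Definition usco_converges (X Y : topologicalType)
    (F : set_system (musco X Y)) (f : musco X Y) : Prop :=
  (exists g : X -> set Y, usco g /\ F (below g)) /\
  [set f] = \bigcap_(g in [set g : X -> set Y | usco g /\ F (below g)]) below g.

(* Filters are proper, i.e. they do not contain the empty set. *)
Definition usco_lambda (X Y : topologicalType) (f : musco X Y) :
    set (set_system (musco X Y)) :=
  [set F | ProperFilter F /\ usco_converges F f].

Definition generated_filter (T : Type) (G : set_system T) : set_system T :=
  smallest (fun F : set_system T => Filter F) G.

Record convergence_structure (T : Type) (lam : T -> set (set_system T)) :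
    Prop := ConvergenceStructure {
  cs_filter : forall f F, lam f F -> ProperFilter F;
  cs_point : forall f, lam f (generated_filter [set [set f]]);
  cs_inter : forall f F1 F2, lam f F1 -> lam f F2 -> lam f (F1 `&` F2);
  cs_finer : forall f F1 F2, lam f F1 -> ProperFilter F2 -> F1 `<=` F2 ->
    lam f F2
}.

(* Main.v *)
Require Import Defs.
From mathcomp Require Import all_boot.
From mathcomp Require Import all_classical topology.

(** The pointwise intersection of a downward directed family of usco maps into
    a Hausdorff space is again usco. Hence every usco map contains a minimal
    one (Zorn), and, for a proper filter F having some [g] as a member, the
    intersection [core F] of all usco g with [g] in F is usco; F converges to f
    iff f is the only minimal usco map contained in [core F]. This gives (3):
    [core F2] is contained in [core F1], so the minimal usco maps inside it can
    only be f. For (2), a minimal usco map h contained in every g with [g] in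
    both filters satisfies h(x) <= G1(x) U G2(x) for all x, with Gi = [core Fi].
    Let O be the open set where f and h are disjoint. On the open part of O
    where G1 and h are disjoint, h is contained in G2; replacing G2 by its
    intersection with h there leaves a usco map contained in G2, hence
    containing f, so this part is empty. Then G1 meets h everywhere on O, and
    the same cut applied to G1 shows that O is empty. So the pointwise
    intersection of f and h is usco, and f = h by minimality. *)

Set Implicit Arguments.
Unset Strict Implicit.
Unset Printing Implicit Defensive.

Local Open Scope classical_set_scope.

(** The tube lemma with an arbitrary filter on the parameter side: compactness leaves finitely many
    local choices of [N], whose intersection is still in [F]. *)
Lemma tube (I : Type) (Y : topologicalType) (A : set Y) (F : set_system I)
    (Q : I -> Y -> Prop) :
  Filter F -> compact A ->
  (forall y, A y -> exists2 N, F N & \forall z \near y, forall i, N i -> Q i z) ->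
  exists V, exists2 N, open V /\ A `<=` V &
    F N /\ forall i z, N i -> V z -> Q i z.
Proof.
move=> FF /compact_near_coveringP cA AQ.
(* Indexing the covering by the small members of F, and not by I, makes V
   independent of the index. *)
pose B (N : set I) := [set M : set I | M `<=` N].
pose P (N : set I) (y : Y) := nbhs y [set z | forall i, N i -> Q i z].
have FB : Filter (filter_from F B).
  apply: filter_from_filter; first by exists setT; apply: filterT.
  move=> M N FM FN; exists (M `&` N); first exact: filterI.
  by move=> K KMN; split=> i /KMN[].
have [y Ay|N FN NA] := cA _ (filter_from F B) P FB.
  have [N FN yN] := AQ y Ay.
  exists ((P N)%classic, B N) => /=.
    by split; [exact: nbhs_interior yN|exists N].
  move=> [z M] /= [zN MN]; apply: filterS zN => w wN i /MN; exact: wN.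
exists (interior (P N)), N; split=> //.
- exact: open_interior.
- move=> y /(NA N (fun _ => id)) yN; exact: nbhs_interior yN.
- by move=> i z Ni /interior_subset /nbhs_singleton; apply.
Qed.

(** * Closed graphs and cuts of usco maps *)

Section Usco.
Context {X Y : topologicalType} (hY : hausdorff_space Y).
Implicit Types (f g h : X -> set Y) (S : set (X -> set Y)).

(** Hausdorffness separates [y] from each point of [g x], [tube] makes the separation uniform on
    this compact value, and upper semicontinuity carries it to nearby points. *)
Lemma usco_closed_graph g x y : usco g -> ~ g x y ->
  exists2 N, nbhs y N & nbhs x [set x' | g x' `<=` ~` N].
Proof.
move=> [gK gU] gxy.
have [z gz|V [N [oV gV] [yN NV]]] :=
  @tube _ Y (g x) (nbhs y) (fun y' z => y' <> z) _ (gK x).2.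
  have yz : y != z by apply/eqP => yz; apply: gxy; rewrite yz.
  move: hY; rewrite open_hausdorff => /(_ _ _ yz)[[A B] /= [yA zB] [oA oB /eqP AB]].
  exists A; first by apply: open_nbhs_nbhs; split=> //; exact: set_mem.
  have : nbhs z B by apply: open_nbhs_nbhs; split=> //; exact: set_mem.
  apply: filterS => w Bw i Ai iw.
  suff: (A `&` B) w by rewrite AB.
  by split=> //; rewrite -iw.
exists N => //; have : nbhs x [set x' | g x' `<=` V].
  by apply: open_nbhs_nbhs; split=> //; exact: gU.
by apply: filterS => x' gx'V z /gx'V Vz Nz; exact: (NV z z).
Qed.

Lemma usco_value_closed g x : usco g -> closed (g x).
Proof. by move=> ug; apply: compact_closed => //; exact: (ug.1 x).2. Qed.

(** Values of the intersection may be empty here. Near a point of [g x] outside [U], the closed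
    graph of [h] keeps [h] away; compactness of [g x] makes this uniform. *)
Lemma open_usco_capS g h U : usco g -> usco h -> open U ->
  open [set x | g x `&` h x `<=` U].
Proof.
move=> ug uh oU; rewrite openE => x ghU.
have [y gy|V [N [oV gV] [xN NV]]] :=
  @tube _ Y (g x) (nbhs x) (fun x' y => h x' y -> U y) _ (ug.1 x).2.
  have [Uy|nUy] := pselect (U y).
    exists setT; first exact: filterT.
    by apply: (@filterS _ _ _ U) => //; apply: open_nbhs_nbhs.
  have [|N yN xN] := @usco_closed_graph h x y uh.
    by move=> hy; apply: nUy; apply: ghU.
  exists [set x' | h x' `<=` ~` N] => //.
  by apply: filterS yN => z Nz i /[apply] /(_ Nz).
have : nbhs x [set x' | g x' `<=` V].
  by apply: open_nbhs_nbhs; split=> //; exact: ug.2.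
move=> gxV; apply: filterS2 gxV xN => x' gV' Nx' y [gy hy].
exact: (NV x' y Nx' (gV' y gy)).
Qed.

Definition cap_on (O : set X) g h : X -> set Y :=
  fun x => [set y | g x y /\ (O x -> h x y)].

(** The boundary of [O] causes no trouble, since cutting only shrinks values: the cut map lies in
    [U] at [x] iff [g x] does, or [x] is in [O] and [g x] meets [h x] only inside [U]. Both
    conditions are open. *)
Lemma usco_cap_on O g h : open O -> usco g -> usco h ->
  (forall x, O x -> g x `&` h x !=set0) -> usco (cap_on O g h).
Proof.
move=> oO ug uh gh0.
have onE x : O x -> cap_on O g h x = g x `&` h x.
  by move=> Ox; apply/seteqP; split=> y [gy hy]; split=> //; exact: hy.
have offE x : ~ O x -> cap_on O g h x = g x.
  by move=> nOx; apply/seteqP; split=> y => [[]|gy] //; split.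
split=> [x|U oU].
  have [Ox|nOx] := pselect (O x); last by rewrite offE //; exact: ug.1.
  rewrite onE //; split; first exact: gh0.
  apply: (@subclosed_compact _ _ (g x)); last by move=> ? [].
    by apply: closedI; exact: usco_value_closed.
  exact: (ug.1 x).2.
rewrite (_ : [set _ | _] =
    [set x | g x `<=` U] `|` (O `&` [set x | g x `&` h x `<=` U])).
  apply: openU; first exact: ug.2.
  by apply: openI => //; exact: open_usco_capS.
apply/seteqP; split=> x /=.
  have [Ox|nOx] := pselect (O x); first by rewrite onE //; right.
  by rewrite offE //; left.
move=> [gU y [gy _]|[Ox ghU] y [gy hy]]; first exact: gU.
by apply: ghU; split=> //; exact: hy.
Qed.

Lemma usco_cap g h : usco g -> usco h -> (forall x, g x `&` h x !=set0) ->
  usco (fun x => g x `&` h x).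
Proof.
move=> ug uh gh0; have := @usco_cap_on setT g h openT ug uh (fun x _ => gh0 x).
rewrite (_ : cap_on _ _ _ = (fun x => g x `&` h x)) //.
by apply/funext => x; apply/seteqP; split=> y [gy hy]; split=> //; exact: hy.
Qed.

(** * Directed intersections and existence of minimal maps *)

(** By compactness, an open [U] containing the intersection at [x] already contains some [g x]
    ([capS]). This gives upper semicontinuity, and nonempty values by taking [U] empty. *)
Lemma usco_directed_bigcap S : S !=set0 -> S `<=` @usco X Y ->
  (forall g h, S g -> S h -> exists k, [/\ S k, sub_graph k g & sub_graph k h]) ->
  usco (fun x => \bigcap_(g in S) g x).
Proof.
move=> [g0 Sg0] Su Sdir.
have capS x U : open U -> \bigcap_(g in S) g x `<=` U ->
    exists2 g, S g & g x `<=` U.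
  move=> oU capU.
  (* The filter of tails of the family; directedness makes the tails a filter base. *)
  pose F := filter_from S (fun g => [set k | S k /\ sub_graph k g]).
  have FF : Filter F.
    apply: filter_from_filter; first by exists g0.
    move=> g h Sg Sh; have [k [Sk kg kh]] := Sdir g h Sg Sh.
    by exists k => // l [Sl lk]; split; split=> // z y /lk; [exact: kg|exact: kh].
  have [y g0y|V [N [oV g0V] [[g Sg gN] NV]]] :=
    @tube _ Y (g0 x) F (fun k y => k x y -> U y) _ ((Su _ Sg0).1 x).2.
    have [Uy|nUy] := pselect (U y).
      exists setT; first exact: filterT.
      by apply: (@filterS _ _ _ U) => //; apply: open_nbhs_nbhs.
    have [g [Sg nogy]] : exists g, S g /\ ~ g x y.
      apply: contrapT => nex; apply: nUy; apply: capU => g Sg.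
      by apply: contrapT => ngy; apply: nex; exists g.
    exists [set k | S k /\ sub_graph k g]; first by exists g.
    have : nbhs y (~` g x).
      apply: open_nbhs_nbhs; split=> //.
      by apply: closed_openC; apply: usco_value_closed; exact: Su.
    by apply: filterS => z ngz k [_ kg] /kg.
  have [k [Sk kg kg0]] := Sdir g g0 Sg Sg0.
  exists k => // y ky; apply: (NV k y) => //; first exact: gN.
  by apply: g0V; exact: kg0.
split=> [x|U oU].
  split.
    apply: contrapT => /nonemptyPn cap0.
    have [|g Sg g0'] := capS x set0 open0; first by rewrite cap0.
    by have [y /g0'] := ((Su _ Sg).1 x).1.
  apply: (@subclosed_compact _ _ (g0 x)).
  - by apply: closed_bigI => g Sg; apply: usco_value_closed; exact: Su.
  - exact: ((Su _ Sg0).1 x).2.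
  - by move=> y; apply.
rewrite (_ : [set _ | _] = \bigcup_(g in S) [set x | g x `<=` U]).
  by apply: bigcup_open => g Sg; exact: (Su _ Sg).2.
apply/seteqP; split=> x /=; first by move=> /(capS _ _ oU).
by move=> [g Sg gU] y capy; apply: gU; exact: capy.
Qed.

Lemma usco_ge_minimal g : usco g -> exists m : musco X Y, below g m.
Proof.
move=> ug; pose T := {h | usco h /\ sub_graph h g}.
(* Reverse inclusion, so that a maximal element for [R] is a minimal map. *)
pose R (s t : T) := `[< sub_graph (sval t) (sval s) >].
have gg : usco g /\ sub_graph g g by split=> // x.
have [||||[m [um mg]] mmax] := @Zorn T R.
- by move=> t; apply/asboolP => x.
- by move=> r s t /asboolP sr /asboolP ts; apply/asboolP => x y /ts /sr.
- move=> [s ps] [t pt] /asboolP /= ts /asboolP /= st; apply: eq_exist.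
  by apply/funext => x; apply/seteqP; split; [exact: st|exact: ts].
- move=> A totA; have [A0|/set0P[t0 At0]] := eqVneq A set0.
    (* The intersection over an empty chain would be all of [Y], so [g] itself serves as bound. *)
    by exists (exist _ g gg) => s; rewrite A0.
  pose S := [set sval t | t in A].
  have uS : usco (fun x => \bigcap_(h in S) h x).
    apply: usco_directed_bigcap; first by exists (sval t0); exists t0.
      by move=> _ [t _ <-]; exact: (svalP t).1.
    move=> _ _ [s As <-] [t At <-].
    have [/asboolP ts|/asboolP st] := totA s t As At.
      by exists (sval t); split=> // [|x]; [exists t|].
    by exists (sval s); split=> // [|x]; [exists s|].
  have pS : usco (fun x => \bigcap_(h in S) h x) /\
      sub_graph (fun x => \bigcap_(h in S) h x) g.
    split=> // x y capy; apply: (svalP t0).2; apply: capy; by exists t0.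
  exists (exist (fun h => usco h /\ sub_graph h g) _ pS) => s As.
  by apply/asboolP => x y; apply; exists s.
suff mm : minimal_usco m by exists (exist _ m mm).
split=> // h uh hm; have ph : usco h /\ sub_graph h g.
  by split=> // x y /hm /mg.
pose t : T := exist _ h ph.
by have /(congr1 sval) : t = exist _ m (conj um mg) by apply/mmax/asboolP.
Qed.

Lemma musco_eq (f h : musco X Y) : sub_graph (sval h) (sval f) -> h = f.
Proof.
case: f h => [f [uf fmin]] [h [uh hmin]] /= hf.
by apply: eq_exist; exact: fmin.
Qed.

(** * The core of a filter *)

Lemma below_cap (F : set_system (musco X Y)) g h : Filter F ->
  F (below g) -> F (below h) -> F (below (fun x => g x `&` h x)).
Proof.
move=> FF Fg Fh; apply: filterS2 Fg Fh => m mg mh x y my.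
by split; [exact: mg|exact: mh].
Qed.

Definition core (F : set_system (musco X Y)) : X -> set Y :=
  fun x => \bigcap_(g in [set g | usco g /\ F (below g)]) g x.

(** Pairwise intersections give directedness; their values are nonempty because a proper filter has
    a minimal map [m] below both [g] and [h]. *)
Lemma usco_core (F : set_system (musco X Y)) : ProperFilter F ->
  (exists g, usco g /\ F (below g)) -> usco (core F).
Proof.
move=> FF Fne; apply: usco_directed_bigcap => // [g []//|g h [ug Fg] [uh Fh]].
have Fgh : F (below (fun x => g x `&` h x)) by exact: below_cap.
exists (fun x => g x `&` h x); split; [split=> //|by move=> ? ? []..].
apply: usco_cap => // x; have [m mgh] := filter_ex Fgh.
have [y my] := ((svalP m).1.1 x).1.
by exists y; exact: mgh.
Qed.

Lemma below_core (F : set_system (musco X Y)) :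
  below (core F) =
  \bigcap_(g in [set g | usco g /\ F (below g)]) below g.
Proof.
apply/seteqP; split=> m mF; first by move=> g Fg x y /mF; apply.
by move=> x y my g Fg; exact: mF.
Qed.

(** A minimal usco map inside [g] lies in [core F], so it can only be [f]. *)
Lemma converges_sub (F : set_system (musco X Y)) (f : musco X Y) g :
  ProperFilter F -> usco_converges F f -> usco g -> sub_graph g (core F) ->
  sub_graph (sval f) g.
Proof.
move=> FF [_ Ff] ug gF; have [m mg] := usco_ge_minimal ug.
suff <- : m = f by [].
suff : [set f] m by [].
by rewrite Ff -below_core => x y /mg /gF.
Qed.

(** * Intersection of two convergent filters *)

Lemma usco_setU g h : usco g -> usco h -> usco (fun x => g x `|` h x).
Proof.
move=> ug uh; split=> [x|U oU].
  split; first by have [y gy] := (ug.1 x).1; exists y; left.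
  by apply: compactU; [exact: (ug.1 x).2|exact: (uh.1 x).2].
rewrite (_ : [set _ | _] = [set x | g x `<=` U] `&` [set x | h x `<=` U]).
  by apply: openI; [exact: ug.2|exact: uh.2].
by apply/seteqP; split=> x /=; rewrite subUset.
Qed.

Lemma open_disjoint g h : usco g -> usco h ->
  open [set x | g x `&` h x = set0].
Proof.
move=> ug uh; rewrite (_ : [set _ | _] = [set x | g x `&` h x `<=` set0]).
  exact: open_usco_capS ug uh open0.
by apply/seteqP; split=> x /=; rewrite subset0.
Qed.

(** The cut of [core F] by [h] over [O] is usco, so it contains [f]; thus [f] lies in [h] on [O],
    where the two are disjoint. *)
Lemma converges_open_eq0 (F : set_system (musco X Y)) (f : musco X Y) O h :
  ProperFilter F -> usco_converges F f -> usco h -> open O ->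
  (forall x, O x -> core F x `&` h x !=set0) ->
  (forall x, O x -> sval f x `&` h x = set0) -> O = set0.
Proof.
move=> FF Ff uh oO Gh fh0; apply/seteqP; split=> // x Ox.
have uG := usco_core FF Ff.1.
have fk : sub_graph (sval f) (cap_on O (core F) h).
  by apply: converges_sub FF Ff (usco_cap_on oO uG uh Gh) _ => z y [].
have [y fy] := ((svalP f).1.1 x).1.
suff : (sval f x `&` h x) y by rewrite fh0.
by split=> //; exact: (fk x y fy).2.
Qed.

(** If [g1] and [g2] witness that [y] is in neither core at [x], their union is a usco map
    admissible for both filters that still misses [y]. *)
Lemma subset_coreU (F1 F2 : set_system (musco X Y)) (h : musco X Y) :
  Filter F1 -> Filter F2 ->
  (forall g, usco g -> (F1 `&` F2) (below g) -> below g h) ->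
  forall x, sval h x `<=` core F1 x `|` core F2 x.
Proof.
move=> FF1 FF2 hF x y hy; apply: contrapT => /not_orP[n1 n2].
apply: n1 => g1 [u1 Fg1]; apply: contrapT => ng1.
apply: n2 => g2 [u2 Fg2]; apply: contrapT => ng2.
have : below (fun x => g1 x `|` g2 x) h.
  apply: hF; first exact: usco_setU.
  by split; [apply: filterS Fg1|apply: filterS Fg2] => m mg z w /mg;
    [left|right].
by move=> /(_ x y hy) [].
Qed.

Lemma converges_inter (F1 F2 : set_system (musco X Y)) (f : musco X Y) :
  ProperFilter F1 -> ProperFilter F2 ->
  usco_converges F1 f -> usco_converges F2 f -> usco_converges (F1 `&` F2) f.
Proof.
move=> FF1 FF2 c1 c2; split.
  have [[g1 [u1 Fg1]] _] := c1; have [[g2 [u2 Fg2]] _] := c2.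
  exists (fun x => g1 x `|` g2 x); split; first exact: usco_setU.
  by split; [apply: filterS Fg1|apply: filterS Fg2] => m mg z w /mg;
    [left|right].
apply/seteqP; split=> [_ -> g [ug [Fg _]]|h hF].
  have : [set f] f by [].
  by rewrite {1}c1.2; apply.
have hcore : forall x, sval h x `<=` core F1 x `|` core F2 x.
  by apply: subset_coreU => g ug Fg; apply: hF.
have uh := (svalP h).1; have uf := (svalP f).1.
pose O := [set x | sval f x `&` sval h x = set0].
have oO : open O by apply: open_disjoint.
have fO x : O x -> sval f x `&` sval h x = set0 by [].
have F2_eq0 V : open V -> V `<=` O ->
    (forall x, V x -> core F1 x `&` sval h x = set0) -> V = set0.
  move=> oV VO V1; apply: (converges_open_eq0 FF2 c2 uh oV) => x Vx; last first.
    exact/fO/VO.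
  have [y hy] := (uh.1 x).1; exists y; split=> //.
  (* On [V] the first core misses [h], so [y] must lie in the second. *)
  have [G1y|//] := hcore x y hy.
  by have : (core F1 x `&` sval h x) y by []; rewrite V1.
have O1 : O `&` [set x | core F1 x `&` sval h x = set0] = set0.
  apply: F2_eq0 => [|x []//|x []//].
  by apply: openI => //; apply: open_disjoint => //; exact: usco_core FF1 c1.1.
have O0 : O = set0.
  apply: (converges_open_eq0 FF1 c1 uh oO) => // x Ox; apply/set0P/eqP => G1h.
  by have : set0 x by rewrite -O1; split.
have fh0 x : sval f x `&` sval h x !=set0.
  by apply/set0P/eqP => fhx; have : O x by []; rewrite O0.
have ufh := usco_cap uf uh fh0.
have fhf : (fun x => sval f x `&` sval h x) = sval f.
  by apply: (svalP f).2 => // x y [].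
suff : f = h by move->.
by apply: musco_eq => x y; rewrite -fhf => -[].
Qed.

(** * Finer filters and point filters *)

Lemma converges_finer (F1 F2 : set_system (musco X Y)) (f : musco X Y) :
  ProperFilter F1 -> ProperFilter F2 -> F1 `<=` F2 ->
  usco_converges F1 f -> usco_converges F2 f.
Proof.
move=> FF1 FF2 F12 c1.
have ex2 : exists g, usco g /\ F2 (below g).
  by have [[g [ug Fg]] _] := c1; exists g; split=> //; exact: F12.
have core21 : sub_graph (core F2) (core F1).
  by move=> x y G2y g [ug Fg]; apply: G2y; split=> //; exact: F12.
split=> //; rewrite -below_core; apply/seteqP; split=> [_ ->|h hF2].
  (* [core F2] is itself a usco map inside [core F1], hence contains [f]. *)
  exact: converges_sub FF1 c1 (usco_core FF2 ex2) core21.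
by rewrite c1.2 -below_core => x y /hF2 /core21.
Qed.

Lemma generated_filter_set1 (T : Type) (t : T) :
  generated_filter [set [set t]] = [set A | A t].
Proof.
apply/seteqP; split=> A.
  apply: (@smallest_sub _ _ _ [set A : set T | A t]) => [|_ ->//].
  by split=> // B C BC Bt; exact: BC.
move=> At F [FF Ft]; apply: (@filterS _ _ _ [set t]) => [_ ->//|].
exact: Ft.
Qed.

Lemma converges_point (f : musco X Y) : usco_converges [set A | A f] f.
Proof.
have ff : below (sval f) f by move=> x.
split; first by exists (sval f); split=> //; exact: (svalP f).1.
apply/seteqP; split=> [_ -> g [_]//|h hf].
by apply: musco_eq; apply: hf; split=> //; exact: (svalP f).1.
Qed.

End Usco.

Theorem theorem12 (X Y : topologicalType) (hY : hausdorff_space Y) :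
  convergence_structure (@usco_lambda X Y).
Proof.
split=> [f F []//|f|f F1 F2 [FF1 c1] [FF2 c2]|f F1 F2 [FF1 c1] FF2 F12].
- rewrite generated_filter_set1; split; last exact: converges_point.
  by split=> //; split=> // B C BC Bf; exact: BC.
- split; last exact: converges_inter.
  split; first by move=> [F10 _]; exact: (@filter_not_empty _ F1).
  split.
  + by split; exact: filterT.
  + by move=> A B [A1 A2] [B1 B2]; split; exact: filterI.
  + by move=> A B AB [A1 A2]; split; [exact: filterS A1|exact: filterS A2].
- by split=> //; exact: converges_finer F12 c1.
Qed.
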